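(* Let $G$ be a group and let $F \leq G$ be a subgroup of finite index $m = [G:F]$ such that $F$ is strongly Howson. Then $G$ is strongly Howson and $$\xi_G(n_1,n_2) \leq \xi_F\big(m(n_1-1)+1,\; m(n_2-1)+1\big) + m - 1$$ for all integers $n_1,n_2 \geq 1$.
   Context: For a finitely generated group $H$, the rank is $\mathrm{rk}(H) = \min\{|X| : H = \langle X\rangle\}$ (infinite if $H$ is not finitely generated). A group $G$ is strongly Howson if for all $n_1,n_2 \in \mathbb{N}$, $$\sup\{\mathrm{rk}(H_1\cap H_2) \mid H_1,H_2\leq G,\ \mathrm{rk}(H_1)\leq n_1,\ \mathrm{rk}(H_2)\leq n_2\} < \infty.$$ In that case $\xi_G(n_1,n_2)$ denotes this supremum, defining a function $\xi_G:\mathbb{N}\times\mathbb{N}\to\mathbb{N}$. The subgroup $F$ is not assumed normal in $G$. *)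

(* Defs.v *)
From mathcomp Require Import all_boot all_order.
From mathcomp Require Import all_classical.

Set Implicit Arguments.
Unset Strict Implicit.
Unset Printing Implicit Defensive.

Local Open Scope classical_set_scope.
Local Open Scope group_scope.

(* Every group occurring below is a subgroup, represented by its set of
   elements, of an ambient group T : groupType; T itself is [set: T].  Except
   for has_index, which is the index in T, the notions depend only on the
   subgroup with its induced group law, not on T. *)
Definition subgroup (T : groupType) (H : set T) : Prop :=
  group_closed [pred x | x \in H].

Definition generated (T : groupType) (X : set T) : set T :=
  smallest (@subgroup T) X.

Definition lcosets_of (T : groupType) (F : set T) : set (set T) :=
  [set [set x * y | y in F] | x in [set: T]].

Definition has_index (T : groupType) (F : set T) (m : nat) : Prop :=
  (lcosets_of F #= `I_m)%card.

Definition generating_sizes (T : groupType) (H : set T) : set nat :=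
  [set n | exists X : set T, (X #= `I_n)%card /\ H = generated X].

(* Ranks live in the extended naturals option nat, None standing for infinity. *)
Definition rk (T : groupType) (H : set T) : option nat :=
  if pselect (exists n, n \in generating_sizes H) is left fgH
  then Some (ex_minn fgH) else None.

Definition rank_leq (r : option nat) (n : nat) : bool :=
  if r is Some k then (k <= n)%N else false.

Definition intersection_ranks (T : groupType) (A : set T) (n1 n2 : nat) :
    set (option nat) :=
  [set r | exists H1 H2 : set T,
    [/\ subgroup H1 /\ H1 `<=` A, subgroup H2 /\ H2 `<=` A,
        rank_leq (rk H1) n1, rank_leq (rk H2) n2 & r = rk (H1 `&` H2)]].

Definition strongly_Howson (T : groupType) (A : set T) : Prop :=
  forall n1 n2 : nat, exists N : nat,
    forall r, intersection_ranks A n1 n2 r -> rank_leq r N.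

(* The supremum is taken in nat; when A is strongly Howson no rank in
   intersection_ranks A n1 n2 is infinite, so none is discarded here. *)
Definition xi (T : groupType) (A : set T) (n1 n2 : nat) : nat :=
  supremum 0%N [set k | intersection_ranks A n1 n2 (Some k)].

(* Main.v *)
Require Import Defs.
From mathcomp Require Import all_boot all_order.
From mathcomp Require Import finmap.
From mathcomp Require Import all_classical.

(** Let [H] be generated by [n] elements and let [k <= m] be the number of
cosets [F g] that meet [H].  The Schreier graph of these cosets, with one edge
[(t, x)] for each vertex and each generator, is connected, so that it has a
spanning tree with [k - 1] edges.  Choosing representatives along this tree
makes the Schreier generator of each tree edge equal to [1], and the [k * n]
Schreier generators generate [H `&` F].  Hence [H `&` F] needs at most
[k * (n - 1) + 1 <= m * (n - 1) + 1] generators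
([rank_leq_setI_finite_index]).

Conversely, a subgroup [L] is generated by [L `&` F] together with
representatives of the cosets of [F] meeting [L] other than [F] itself, which
are at most [m - 1] ([rank_leq_finite_index]).  Applying the first bound to
[H1] and [H2], the hypothesis on [F] to
[(H1 `&` F) `&` (H2 `&` F) = (H1 `&` H2) `&` F], and the second bound to
[L = H1 `&` H2] gives the theorem. *)

Set Implicit Arguments.
Unset Strict Implicit.
Unset Printing Implicit Defensive.

Local Open Scope classical_set_scope.
Local Open Scope group_scope.

(** * Subgroups and generation *)

Section Subgroups.
Variable G : groupType.
Implicit Types (A H K X : set G) (g h x y : G).

Lemma subgroupE H :
  subgroup H <-> H 1 /\ forall x y, H x -> H y -> H (x / y).
Proof.
split=> [[H1 HB]|[H1 HB]]; split.
- by move: H1; rewrite !inE.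
- by move=> x y Hx Hy; have := HB x y; rewrite !inE; apply.
- by rewrite !inE.
- by move=> x y; rewrite !inE; apply: HB.
Qed.

Lemma subgroup1 H : subgroup H -> H 1.
Proof. by case/subgroupE. Qed.

Lemma subgroupB H x y : subgroup H -> H x -> H y -> H (x / y).
Proof. by case/subgroupE=> _; apply. Qed.

Lemma subgroupV H x : subgroup H -> H x -> H x^-1.
Proof.
by move=> sH Hx; rewrite -div1g; apply: subgroupB => //; apply: subgroup1.
Qed.

Lemma subgroupM H x y : subgroup H -> H x -> H y -> H (x * y).
Proof.
move=> sH Hx Hy; rewrite -[y]invgK; apply: subgroupB => //.
exact: subgroupV.
Qed.

Lemma subgroupI H K : subgroup H -> subgroup K -> subgroup (H `&` K).
Proof.
move=> sH sK; apply/subgroupE; split; first by split; apply: subgroup1.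
by move=> x y [Hx Kx] [Hy Ky]; split; apply: subgroupB.
Qed.

Lemma subgroup_generated X : subgroup (generated X).
Proof.
apply/subgroupE; split=> [|x y Xx Xy] A [sA XA]; first exact: subgroup1.
by apply: subgroupB => //; [apply: Xx|apply: Xy].
Qed.

Lemma sub_generated X : X `<=` generated X.
Proof. exact: sub_gen_smallest. Qed.

Lemma generated_sub X H : subgroup H -> X `<=` H -> generated X `<=` H.
Proof. exact: smallest_sub. Qed.

End Subgroups.

(** * Ranks *)

Section Ranks.
Variable G : groupType.
Implicit Types (H : set G) (s : seq G).

(** Repetitions in [s] are harmless, so that upper bounds on ranks can be shown
with explicit lists of generators. *)
Lemma rank_leqP H n :
  rank_leq (rk H) n <->
  exists2 s, (size s <= n)%N & H = generated [set` s].
Proof.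
rewrite /rk; split.
  case: pselect => [fgH|//] /=; case: ex_minnP => k.
  rewrite inE => -[X [Xk ->]] _ kn.
  exists (enum_fset (fset_set X)); first by rewrite (card_fset_set Xk).
  by rewrite fset_setK //; exists k.
case=> s sn Hs.
have szH : size (undup s) \in generating_sizes H.
  rewrite inE; exists [set` s]; split=> //.
  have -> : [set` s] = [set` [fset x in s]%fset].
    by apply/seteqP; split=> x /=; rewrite !inE.
  by apply/card_eq_fsetP; rewrite card_fseq.
case: pselect => [fgH|[]]; last by exists (size (undup s)).
case: ex_minnP => k _ /(_ _ szH) ks /=.
exact: leq_trans ks (leq_trans (size_undup s) sn).
Qed.

Lemma rank_leq_trans r n p : (n <= p)%N -> rank_leq r n -> rank_leq r p.
Proof. by case: r => //= k np kn; apply: leq_trans np. Qed.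

End Ranks.

(** * Partial transversals of a subgroup of finite index *)

Section Transversals.
Variable G : groupType.
Implicit Types (A F H X : set G) (T : seq G) (g h x t : G).

Definition covered A T g := exists2 t, t \in T & A (g / t).

(** The cosets are the right cosets [F t], and [H] need not contain [F]: the
elements of [T] represent distinct cosets of [H `&` F] in [H]. *)
Definition partial_transversal F H T :=
  [/\ uniq T, 1 \in T, {in T, forall t, H t}
    & {in T &, forall t u, F (t / u) -> t = u}].

(** The set of covered elements is stable under right multiplication by [X] as
soon as the translates of [T] are covered, and it contains [1]. *)
Lemma covered_generated A X T :
    subgroup A -> 1 \in T ->
    {in T, forall t x, X x -> covered A T (t * x) /\ covered A T (t / x)} ->
  forall h, generated X h -> covered A T h.
Proof.
move=> sA T1 TX.
pose S : set G := [set h | forall g, covered A T g ->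
  covered A T (g * h) /\ covered A T (g / h)].
have covM g t h : t \in T -> A (g / t) -> covered A T (t * h) ->
    covered A T (g * h).
  move=> Tt Agt [u Tu Au]; exists u => //.
  have -> : g * h / u = (g / t) * (t * h / u) by rewrite !mulgA mulgVK.
  exact: subgroupM.
have sS : subgroup S.
  apply/subgroupE; split=> [g Cg|x y Sx Sy g Cg]; first by rewrite divg1 mulg1.
  rewrite invgM invgK !mulgA.
  by split; [apply: (Sy _ (Sx _ Cg).1).2 | apply: (Sx _ (Sy _ Cg).1).2].
have XS : X `<=` S.
  move=> x Xx g [t Tt Agt]; have [Cx CV] := TX t Tt x Xx.
  by split; apply: covM Agt _.
move=> h /(generated_sub sS XS)/(_ 1) []; last by rewrite mul1g.
by exists 1 => //; rewrite divg1; apply: subgroup1.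
Qed.

Lemma partial_transversal1 F H : subgroup H -> partial_transversal F H [:: 1].
Proof.
move=> sH; split=> //; first by rewrite inE.
  by move=> t; rewrite inE => /eqP ->; apply: subgroup1.
by move=> t u; rewrite !inE => /eqP -> /eqP ->.
Qed.

Lemma partial_transversal_cons F H T g :
    subgroup F -> partial_transversal F H T -> H g -> ~ covered F T g ->
  g \notin T /\ partial_transversal F H (g :: T).
Proof.
move=> sF [uT T1 TH TF] Hg Cg.
have gT : g \notin T.
  by apply/negP=> Tg; apply: Cg; exists g; rewrite // mulgV; apply: subgroup1.
split=> //; split=> /=; first by rewrite gT.
- by rewrite inE T1 orbT.
- by move=> t; rewrite inE => /predU1P[->|/TH].
move=> t u; rewrite !inE => /predU1P[->|Tt] /predU1P[->|Tu] //.
- by move=> Fgu; case: Cg; exists u.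
- move=> /(subgroupV sF); rewrite invgM invgK => Fgt.
  by case: Cg; exists t.
- exact: TF.
Qed.

(** The index counts left cosets; inversion matches them with the right cosets
that [T] represents. *)
Lemma size_partial_transversal F H T m :
    subgroup F -> has_index F m -> partial_transversal F H T ->
  (size T <= m)%N.
Proof.
move=> sF Fm [uT _ _ TF].
pose f i := [set (T`_i)^-1 * y | y in F]%R.
have injf : {in `I_(size T) &, injective f}.
  move=> i j; rewrite !inE /= => iT jT fij.
  have : f i (T`_i)^-1%R by exists 1; [apply: subgroup1|rewrite mulg1].
  rewrite fij => -[y Fy /(congr1 (fun z => T`_j * z)%R)].
  rewrite mulVKg => yE; apply/eqP; rewrite eq_sym.
  by rewrite -(nth_uniq 1%R jT iT uT); apply/eqP/TF; rewrite ?mem_nth -?yE.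
rewrite -card_le_II -(card_le_eqr Fm) -(card_le_eql (inj_card_eq injf)).
by apply: subset_card_le => _ [i _ <-]; exists (T`_i)^-1%R.
Qed.

(** Maximality replaces the recursive construction of a transversal: an
uncovered element would extend [T].  The property [P] leaves room for a further
condition to be kept during the extension. *)
Lemma maximal_partial_transversal F H m (P : seq G -> Prop) T0 :
    subgroup F -> has_index F m -> P T0 ->
    (forall T, P T -> partial_transversal F H T) ->
  exists2 T, P T & forall g, ~ P (g :: T).
Proof.
move=> sF Fm PT0 PF.
pose p n := `[< exists2 T, P T & size T = n >].
have exp : exists n, p n by exists (size T0); apply/asboolP; exists T0.
have ubp n : p n -> (n <= m)%N.
  by move=> /asboolP[T /PF PT <-]; apply: size_partial_transversal PT.
case: (ex_maxnP exp ubp) => _ /asboolP[T PT <-] maxT.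
exists T => // g PgT.
have /maxT : p (size (g :: T)) by apply/asboolP; exists (g :: T).
by rewrite ltnn.
Qed.

End Transversals.

(** * Generating a group from a subgroup of finite index *)

Section FromFiniteIndex.
Variables (G : groupType) (F : set G) (m : nat).
Hypotheses (sF : subgroup F) (Fm : has_index F m).

(** A transversal containing [1] together with generators of [L `&` F]
generates [L], and [1] can be dropped. *)
Lemma rank_leq_finite_index (L : set G) n :
  subgroup L -> rank_leq (rk (L `&` F)) n -> rank_leq (rk L) (n + m - 1).
Proof.
move=> sL /rank_leqP[Y Yn LFE]; apply/rank_leqP.
have [T ptT maxT] := maximal_partial_transversal sF Fm
  (partial_transversal1 F sL) (fun T (ptT : partial_transversal F L T) => ptT).
have Tm := size_partial_transversal sF Fm ptT.
have [_ T1 TL _] := ptT.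
exists (Y ++ rem 1%R T).
  rewrite size_cat size_rem // -subn1 -addnBA ?leq_add ?leq_sub2r //.
  by apply: leq_trans Tm; case: (T) T1.
set K := generated _; have sK : subgroup K by apply: subgroup_generated.
have YK : generated [set` Y] `<=` K.
  apply: generated_sub => // y Yy; apply: sub_generated => /=.
  by rewrite mem_cat; apply/orP; left.
have TK t : t \in T -> K t.
  have [-> _|t1 Tt] := eqVneq t 1%R; first exact: subgroup1.
  move: Tt; rewrite (perm_mem (perm_to_rem T1)) inE (negPf t1) => /= Tt.
  by apply: sub_generated; rewrite /= mem_cat Tt orbT.
apply/seteqP; split=> [h Lh|].
  have [t Tt Fht] : covered F T h.
    by apply: contrapT => /(partial_transversal_cons sF ptT Lh)[_ /maxT].
  rewrite -(mulgVK t h); apply: subgroupM (TK t Tt) => //.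
  by apply: YK; rewrite -LFE; split=> //; apply: subgroupB (TL t Tt).
apply: generated_sub => // y /=; rewrite mem_cat => /orP[Yy|/mem_rem/TL //].
have : (L `&` F) y by rewrite LFE; apply: sub_generated.
by case.
Qed.

End FromFiniteIndex.

(** * Schreier generators *)

Section Schreier.
Variables (G : groupType) (F : set G) (m : nat).
Hypotheses (sF : subgroup F) (Fm : has_index F m).
Implicit Types (T X : seq G).

(** An edge from [t] to the coset of [t * x] has a trivial Schreier generator
when [t * x] is in [T].  A spanning tree serves only to provide [size T - 1]
such edges, so that counting them replaces the tree. *)
Definition schreier_transversal X T :=
  partial_transversal F (generated [set` X]) T /\
  (size T <= (count (mem T) [seq (t * x)%g | t <- T, x <- X]).+1)%N.

(** Connectedness of the Schreier graph: from a partial transversal that is not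
yet complete, some generator or inverse of a generator leads to a new coset,
and the new representative comes with a new internal edge. *)
Lemma exists_schreier_transversal X :
  exists2 T, schreier_transversal X T &
    forall h, generated [set` X] h -> covered F T h.
Proof.
have sH := subgroup_generated [set` X].
have st1 : schreier_transversal X [:: 1%R].
  by split=> //; apply: partial_transversal1.
have [T [ptT edT] maxT] := maximal_partial_transversal sF Fm st1
  (fun T (stT : schreier_transversal X T) => proj1 stT).
exists T => //; have [_ T1 TH _] := ptT.
pose E := [seq t * x | t <- T, x <- X].
apply: covered_generated => // t Tt x Xx.
have Hx : generated [set` X] x by apply: sub_generated.
(* The uncovered coset of [g] is joined to [T] by a new edge, which leaves
   [T] in the first case and enters [T] in the second. *)
have addT g : generated [set` X] g ->
    g \in E \/ (exists2 y, y \in X & g * y \in T) -> covered F T g.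
  move=> Hg edge; apply: contrapT.
  move=> /(partial_transversal_cons sF ptT Hg)[gT ptgT].
  apply: (maxT g); split=> //; rewrite allpairs_cons count_cat /=.
  rewrite ltnS; apply: leq_trans edT _.
  have -> : count (mem (g :: T)) E = (count_mem g E + count (mem T) E)%N.
    rewrite -count_predUI [X in (_ + X)%N](@eq_count _ _ pred0) ?count_pred0.
      by rewrite addn0; apply: eq_count => y; rewrite /= inE.
    by move=> y /=; apply/negP => /andP[/eqP ->]; apply/negP.
  rewrite addnA -addn1 addnC leq_add2r addn_gt0 -!has_count.
  case: edge => [Eg|[y Xy Tgy]]; apply/orP; [right|left].
    by rewrite has_pred1.
  apply/hasP; exists (g * y); first exact: map_f.
  by rewrite /= inE Tgy orbT.
split; apply: addT.
- by apply: subgroupM (TH t Tt) _.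
- by left; apply: allpairs_f.
- by apply: subgroupB (TH t Tt) _.
- by right; exists x; rewrite // mulgVK.
Qed.

Definition coset_rep T g :=
  nth 1%R T (find (fun t => `[< F (g / t) >]) T).

Lemma coset_repP T g :
  covered F T g -> coset_rep T g \in T /\ F (g / coset_rep T g).
Proof.
move=> [t Tt Fgt].
have hasT : has (fun t => `[< F (g / t) >]) T.
  by apply/hasP; exists t => //; apply/asboolP.
by split; [rewrite mem_nth // -has_find|apply/asboolP/(nth_find 1%R hasT)].
Qed.

Lemma coset_rep_uniq H T g t :
  partial_transversal F H T -> t \in T -> F (g / t) -> coset_rep T g = t.
Proof.
move=> [_ _ _ TF] Tt Fgt.
have [Tr Fgr] : coset_rep T g \in T /\ F (g / coset_rep T g).
  by apply: coset_repP; exists t.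
apply: TF => //; rewrite -(divgKA g); apply: subgroupM => //.
by rewrite -[_ / g]invgK invgM invgK; apply: subgroupV.
Qed.

(** The generator of the edge [(t, x)] depends only on [y = t * x]; it is
[t * x * u^-1] with [u] the representative of the coset that the edge reaches.
The edges inside [T] are left out, having generator [1]. *)
Definition schreier_generators X T :=
  [seq y / coset_rep T y |
     y <- [seq t * x | t <- T, x <- X] & y \notin T].

(** Let [K] be generated by the Schreier generators.  The products [k * t] with
[k] in [K] and [t] in [T] are stable under right multiplication by [X] and its
inverses, hence exhaust [generated X]; such a product lies in [F] only if
[t = 1]. *)
Lemma generated_schreier_generators X T :
    partial_transversal F (generated [set` X]) T ->
    (forall h, generated [set` X] h -> covered F T h) ->
  generated [set` X] `&` F = generated [set` schreier_generators X T].
Proof.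
set H := generated _ => ptT covT; have [_ T1 TH _] := ptT.
have sH : subgroup H by apply: subgroup_generated.
set K := generated _; have sK : subgroup K by apply: subgroup_generated.
have HE t x : t \in T -> x \in X -> H (t * x).
  by move=> Tt Xx; apply: subgroupM (TH t Tt) _ => //; apply: sub_generated.
have KHF : K `<=` H `&` F.
  apply: generated_sub; first exact: subgroupI.
  move=> _ /mapP[y + ->]; rewrite mem_filter.
  move=> /andP[_ /allpairsP[[t x] [/= Tt Xx ->]]].
  have [Tr Fr] := coset_repP (covT _ (HE t x Tt Xx)).
  by split=> //; apply: subgroupB (HE t x Tt Xx) (TH _ Tr).
have KE t x : t \in T -> x \in X -> K (t * x / coset_rep T (t * x)).
  move=> Tt Xx; have [TtX|TtX] := boolP (t * x \in T).
    rewrite (coset_rep_uniq ptT TtX) mulgV; exact: subgroup1.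
  apply: sub_generated; apply: map_f.
  by rewrite mem_filter TtX; apply: allpairs_f.
apply/seteqP; split=> // h [Hh Fh].
have [|t Tt Kht] := covered_generated sK T1 _ Hh.
  move=> t Tt x Xx; split.
    exists (coset_rep T (t * x)); last exact: KE.
    by have [] := coset_repP (covT _ (HE t x Tt Xx)).
  (* The edge labelled [x] that ends in the coset of [t] starts at [u]. *)
  have Htx : H (t / x).
    by apply: subgroupB (TH t Tt) _ => //; apply: sub_generated.
  have [Tu Fu] := coset_repP (covT _ Htx); set u := coset_rep T _ in Tu Fu.
  exists u => //; have := KE u x Tu Xx.
  rewrite (coset_rep_uniq ptT Tt) => [/(subgroupV sK)|].
    by rewrite !invgM !invgK mulgA.
  by have := subgroupV sF Fu; rewrite !invgM !invgK !mulgA.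
have t1 : t = 1%R.
  have [_ _ _ TF] := ptT; apply: TF => //.
  rewrite invg1 mulg1; have [_ Fht] := KHF _ Kht.
  rewrite -[t]invgK; apply: (subgroupV sF); rewrite -[t^-1](mulKg h).
  by apply: (subgroupM sF) Fht; apply: subgroupV.
by rewrite -[h]divg1 -t1.
Qed.

(** There are [size T * size X] edges, of which at least [size T - 1] have
trivial generator. *)
Lemma rank_leq_setI_finite_index (H : set G) n :
    (0 < n)%N -> rank_leq (rk H) n ->
  rank_leq (rk (H `&` F)) (m * (n - 1) + 1).
Proof.
move=> n0 /rank_leqP[X Xn ->]; apply/rank_leqP.
have [T stT covT] := exists_schreier_transversal X.
exists (schreier_generators X T); last first.
  by apply: generated_schreier_generators (proj1 stT) covT.
have Tm := size_partial_transversal sF Fm (proj1 stT).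
have -> : size (schreier_generators X T) =
    (size T * size X - count (mem T) [seq (t * x)%g | t <- T, x <- X])%N.
  rewrite size_map size_filter -(size_allpairs *%g T X).
  by rewrite -(count_predC (mem T)) addKn.
rewrite leq_subLR (leq_trans (leq_mul (leqnn _) Xn)) //.
case: n n0 {Xn} => // n _; rewrite subn1 mulnS addn1 addnS -addSn.
by apply: leq_add; [exact: proj2 stT|rewrite leq_mul].
Qed.

End Schreier.

(** * Suprema of ranks *)

Section Xi.
Variable G : groupType.
Implicit Types A : set G.

Lemma rank_leq_xi A n1 n2 r :
  strongly_Howson A -> intersection_ranks A n1 n2 r ->
  rank_leq r (xi A n1 n2).
Proof.
move=> howA Ar; have [N leN] := howA n1 n2.
case: r Ar (leN _ Ar) => [k|//] Ak _ /=.
apply: (@ge_supremum_Nmem _ nat) => //.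
by apply: nat_supremums_neq0; exists N => j /leN.
Qed.

Lemma xi_leq A n1 n2 N :
  (forall r, intersection_ranks A n1 n2 r -> rank_leq r N) ->
  (xi A n1 n2 <= N)%N.
Proof.
move=> leN; rewrite /xi /supremum; case: ifPn => // _.
by case: xgetP => // k _ [_]; apply=> j /leN.
Qed.

Lemma intersection_ranks_mono A n1 n2 p1 p2 :
  (n1 <= p1)%N -> (n2 <= p2)%N ->
  intersection_ranks A n1 n2 `<=` intersection_ranks A p1 p2.
Proof.
move=> np1 np2 r [H1 [H2 [sH1 sH2 rk1 rk2 ->]]]; exists H1, H2.
by split=> //; [apply: rank_leq_trans rk1|apply: rank_leq_trans rk2].
Qed.

Lemma intersection_ranks_finite_index (F : set G) m n1 n2 r :
    subgroup F -> has_index F m -> strongly_Howson F ->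
    (0 < n1)%N -> (0 < n2)%N -> intersection_ranks [set: G] n1 n2 r ->
  rank_leq r (xi F (m * (n1 - 1) + 1) (m * (n2 - 1) + 1) + m - 1).
Proof.
move=> sF Fm howF n1_gt0 n2_gt0 [H1 [H2 [[sH1 _] [sH2 _] rk1 rk2 ->]]].
apply: (rank_leq_finite_index sF Fm (subgroupI sH1 sH2)).
apply: rank_leq_xi => //; exists (H1 `&` F), (H2 `&` F); split.
- by split; [apply: subgroupI|move=> x []].
- by split; [apply: subgroupI|move=> x []].
- exact: rank_leq_setI_finite_index.
- exact: rank_leq_setI_finite_index.
- by rewrite setIACA setIid.
Qed.

End Xi.

Theorem theorem3p2 (G : groupType) (F : set G) (m : nat)
    (subF : subgroup F) (indexF : has_index F m) (howF : strongly_Howson F) :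
  strongly_Howson [set: G]%classic /\
  forall n1 n2 : nat, (1 <= n1)%N -> (1 <= n2)%N ->
    (xi [set: G]%classic n1 n2
       <= xi F (m * (n1 - 1) + 1) (m * (n2 - 1) + 1) + m - 1)%N.
Proof.
split=> [n1 n2|n1 n2 n1_gt0 n2_gt0]; last first.
  by apply: xi_leq => r; apply: intersection_ranks_finite_index.
(* The bound needs positive arguments, and [n1] or [n2] may be zero. *)
eexists=> r /(intersection_ranks_mono (leqnSn n1) (leqnSn n2)).
exact: (intersection_ranks_finite_index subF indexF howF).
Qed.
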